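(* Let $P$ be a probability measure on $(\Omega,\mathcal{M})$, $\tau:\Omega\to[0,\infty]$ measurable, and $\gamma\ne0,-1$ with $0<E_P[\tau^\gamma]<\infty$. Define the probability measure $dQ_\gamma=\tau^\gamma dP/E_P[\tau^\gamma]$, and for $\beta\in\mathbb{R}$ and $I\subset\mathbb{R}$ define $\mathcal{U}^\gamma_\beta(P)=\{Q:R_\beta(Q\|P)\le R_\beta(Q_\gamma\|P)\}$ and $\mathcal{U}^\gamma_I(P)=\{Q:R_\alpha(Q\|P)\le R_\alpha(Q_\gamma\|P)\text{ for all }\alpha\in I\}$. Then $Q_\gamma\in\mathcal{U}^\gamma_I(P)\subset\mathcal{U}^\gamma_\beta(P)$ for any $\beta\in I$, and: (1) If $\gamma>0$, $$\sup_{Q\in\mathcal{U}^\gamma_{(1,\infty)}(P)}\log\int\tau dQ=\sup_{Q\in\mathcal{U}^\gamma_{1+\gamma^{-1}}(P)}\log\int\tau dQ=\log\int\tau dQ_\gamma=\inf_{c>1}\Big\{\frac1c\log\int\tau^cdP+\frac1{c-1}R_{c/(c-1)}(Q_\gamma\|P)\Big\},$$ with the infimum achieved at $c=\gamma+1$. (2) If $\gamma\in(-1,0)$, $\tau<\infty$ $P$-a.s., and $E_P[\tau^{\gamma+1}]<\infty$, then $$\inf_{Q\in\mathcal{U}^\gamma_{(-\infty,0)}(P)}\log\int\tau dQ=\inf_{Q\in\mathcal{U}^\gamma_{1+\gamma^{-1}}(P)}\log\int\tau dQ=\log\int\tau dQ_\gamma=\sup_{c<1,c\ne0}\Big\{\frac1c\log\int\tau^cdP-\frac1{1-c}R_{1/(1-c)}(P\|Q_\gamma)\Big\},$$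 with the supremum achieved at $c=\gamma+1$. (3) If $\gamma<-1$, $$\inf_{Q\in\mathcal{U}^\gamma_{(0,1)}(P)}\log\int\tau dQ=\inf_{Q\in\mathcal{U}^\gamma_{1+\gamma^{-1}}(P)}\log\int\tau dQ=\log\int\tau dQ_\gamma=\sup_{c<1,c\ne0}\Big\{\frac1c\log\int\tau^cdP-\frac1{1-c}R_{1/(1-c)}(P\|Q_\gamma)\Big\},$$ with the supremum achieved at $c=\gamma+1$.
   Context: Powers $\tau^c=\exp(c\log\tau)$ with continuous extensions of $\exp,\log$ to extended reals; conventions $-\infty+\infty=\infty$ in upper bounds and $\infty-\infty=-\infty$ in lower bounds. Sets of $Q$ range over probability measures on $(\Omega,\mathcal{M})$. Rényi divergence: let $\nu$ be a $\sigma$-finite positive measure with $dP=p\,d\nu$, $dQ=q\,d\nu$. For $\alpha\in(0,1)$, $R_\alpha(Q\|P)=\frac{1}{\alpha(\alpha-1)}\log\int_{p>0}q^\alpha p^{1-\alpha}\,d\nu$; for $\alpha>1$, the same formula if $Q\ll P$ and $R_\alpha(Q\|P)=+\infty$ if $Q\not\ll P$; for $\alpha<0$, $R_\alpha(Q\|P)=R_{1-\alpha}(P\|Q)$. *)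

(* Defs.v *)
From HB Require Import structures.
From mathcomp Require Import all_boot all_order all_algebra.
From mathcomp Require Import all_classical all_reals all_analysis.
From mathcomp Require Import measurable_realfun.
From Stdlib Require Import ClassicalEpsilon.
Set Implicit Arguments.
Unset Strict Implicit.
Unset Printing Implicit Defensive.
Import Order.TTheory GRing.Theory Num.Theory.
Import numFieldNormedType.Exports.
Local Open Scope classical_set_scope.
Local Open Scope ring_scope.
Local Open Scope ereal_scope.

Section renyi_defs.
Context {d : measure_display} {T : measurableType d} {R : realType}.

(* Extended logarithm on [0, +oo]: log 0 = -oo, log +oo = +oo
   (continuous extension). Negative arguments never occur. *)
Definition eln (x : \bar R) : \bar R :=
  match x with
  | r%:E => if (0 < r)%R then (ln r)%:E else -oo
  | +oo => +oo
  | -oo => -oo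
  end.

(* tau ^ c = exp (c log tau) for tau in [0, +oo], c real, with the
   continuous extensions exp(-oo) = 0, exp(+oo) = +oo (and 0 * oo = 0). *)
Definition epow (t : \bar R) (c : R) : \bar R :=
  match t with
  | r%:E => if (0 < r)%R then (r `^ c)%:E
            else if (0 < c)%R then 0 else if (c < 0)%R then +oo else 1
  | +oo => if (0 < c)%R then +oo else if (c < 0)%R then 0 else 1
  | -oo => 0
  end.

Definition is_density (nu mu : {measure set T -> \bar R}) (f : T -> R) : Prop :=
  [/\ measurable_fun setT f, (forall x, 0 <= f x)%R &
      forall A, measurable A -> mu A = \int[nu]_(x in A) (f x)%:E].

(* a chosen density (it exists by Radon-Nikodym whenever mu << nu, nu finite) *)
Definition density (nu mu : {measure set T -> \bar R}) : T -> R :=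
  epsilon (inhabits (fun _ => 0%R)) (is_density nu mu).

Definition abs_cont (Q P : {measure set T -> \bar R}) : Prop :=
  forall A, measurable A -> P A = 0 -> Q A = 0.

(* Renyi divergence for alpha > 0 (alpha <> 1), computed with the
   dominating finite measure nu = P + Q; the value does not depend on nu. *)
Definition renyi_pos (alpha : R) (Q P : probability T R) : \bar R :=
  let nu := measure_add P Q in
  let p := density nu P in
  let q := density nu Q in
  if (1 < alpha)%R && ~~ `[< abs_cont Q P >] then +oo
  else ((alpha * (alpha - 1))^-1)%:E *
       eln (\int[nu]_(x in [set x | (0 < p x)%R])
              ((q x) `^ alpha * (p x) `^ (1 - alpha))%:E).

(* R_alpha(Q || P); for alpha < 0, R_alpha(Q||P) = R_{1-alpha}(P||Q).
   (alpha = 0, 1 are not used.) *)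
Definition renyi (alpha : R) (Q P : probability T R) : \bar R :=
  if (alpha < 0)%R then renyi_pos (1 - alpha) P Q else renyi_pos alpha Q P.

Definition Ubeta (P Qg : probability T R) (beta : R) : set (probability T R) :=
  [set Q | renyi beta Q P <= renyi beta Qg P].

Definition UI (P Qg : probability T R) (I : set R) : set (probability T R) :=
  [set Q | forall alpha, I alpha -> renyi alpha Q P <= renyi alpha Qg P].

End renyi_defs.

(* Main.v *)
Require Import Defs.
From HB Require Import structures.
From mathcomp Require Import all_boot all_order all_algebra.
From mathcomp Require Import all_classical all_reals all_analysis.
From mathcomp Require Import measurable_realfun ring.
Set Implicit Arguments.
Unset Strict Implicit.
Unset Printing Implicit Defensive.
Import Order.TTheory GRing.Theory Num.Theory.
Import numFieldNormedType.Exports.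
Local Open Scope classical_set_scope.
Local Open Scope ring_scope.
Local Open Scope ereal_scope.

(* Writing [p], [q] for densities of [P], [Q] with respect to [nu = P + Q],
   all bounds are instances of Hoelder's inequality in the form
     int u^s v^(1-s) <= (int u)^s (int v)^(1-s),   0 < s < 1.
   For [c > 1], [u = p tau^c] and [v = q^a p^(1-a)] with [a = c / (c - 1)] give
     log E_Q tau <= 1/c log E_P tau^c + 1/(c-1) R_a(Q || P);
   for [c < 1], the choices [u = q tau], [v = p^a q^(1-a)] (if [c > 0]) or
   [u = p tau^c], [v = q tau] (if [c < 0]), with [a = 1 / (1 - c)], give
     log E_Q tau >= 1/c log E_P tau^c - 1/(1-c) R_a(P || Q).
   At [c = gamma + 1] the divergence on the right is [R_beta(Q || P)] with
   [beta = 1 + 1/gamma], so that its value at any [Q] of the ambiguity set is at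
   most the one at [Q_gamma]; and for [Q = Q_gamma] both sides equal
   [log E_P tau^(gamma+1) - log E_P tau^gamma]. *)

(** * Radon-Nikodym densities with respect to a finite dominating measure *)

Section densities.
Context {d : measure_display} {T : measurableType d} {R : realType}.

(** Turns a bound on the total mass into the finiteness structure that the Radon-Nikodym results
    work with; restriction to the whole space changes no value. *)
Lemma finite_measure_of (m : {measure set T -> \bar R}) : m setT < +oo ->
  exists m' : {finite_measure set T -> \bar R},
    m' = m :> {measure set T -> \bar R}.
Proof.
move=> moo; exists (mfrestr measurableT moo); apply/eq_measure/funext => A.
by rewrite /= /mfrestr /mrestr/= setIT.
Qed.

Lemma measure_addT (P Q : probability T R) : measure_add P Q setT < +oo.
Proof.
rewrite measure_addE; apply: lte_add_pinfty.
  exact: le_lt_trans (probability_le1 P measurableT) (ltry 1).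
exact: le_lt_trans (probability_le1 Q measurableT) (ltry 1).
Qed.

Lemma measure_addC (m1 m2 : {measure set T -> \bar R}) :
  measure_add m1 m2 = measure_add m2 m1 :> {measure set T -> \bar R}.
Proof.
apply/eq_measure/funext => A.
rewrite -[LHS]/(measure_add m1 m2 A) -[RHS]/(measure_add m2 m1 A).
by rewrite !measure_addE addeC.
Qed.

(** [epsilon] returns a density as soon as one exists; the Radon-Nikodym derivative, made real by
    [fine], is the witness. *)
Lemma densityP (nu : {measure set T -> \bar R})
    (mu : {finite_measure set T -> \bar R}) : nu setT < +oo ->
  abs_cont mu nu -> is_density nu mu (density nu mu).
Proof.
case/finite_measure_of => m <-.
move=> /null_content_dominatesP/radon_nikodym_sigma_finite[f [f0 ff intf muE]].
apply: ClassicalEpsilon.epsilon_spec; exists (fine \o f); split.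
- by apply: measurableT_comp => //; exact: measurable_int intf.
- by move=> x; rewrite fine_ge0.
- by move=> A mA; rewrite [LHS]muE//; apply: eq_integral => x _ /=; rewrite fineK.
Qed.

Lemma density_addl (P Q : probability T R) :
  is_density (measure_add P Q) P (density (measure_add P Q) P).
Proof.
apply: (@densityP _ P (measure_addT P Q)) => A mA /eqP.
rewrite -[X in X == _]/(measure_add P Q A) measure_addE padde_eq0 ?measure_ge0//.
by move=> /andP[/eqP].
Qed.

Lemma density_addr (P Q : probability T R) :
  is_density (measure_add P Q) Q (density (measure_add P Q) Q).
Proof.
apply: (@densityP _ Q (measure_addT P Q)) => A mA /eqP.
rewrite -[X in X == _]/(measure_add P Q A) measure_addE padde_eq0 ?measure_ge0//.
by move=> /andP[_ /eqP].
Qed.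

Lemma density_ae_eq (nu : {measure set T -> \bar R})
    (mu : {finite_measure set T -> \bar R}) (f : T -> R) (g : T -> \bar R) :
  is_density nu mu f -> measurable_fun setT g ->
  (forall A, measurable A -> mu A = \int[nu]_(x in A) g x) ->
  ae_eq nu setT (EFin \o f) g.
Proof.
move=> [mf f0 fE] mg gE; apply: integral_ae_eq => //.
- apply/integrableP; split; first exact/measurable_EFinP.
  under eq_integral do rewrite /= ger0_norm//.
  by rewrite -fE// ltey_eq fin_num_measure.
- by move=> A _ mA; rewrite -fE//; exact: gE.
Qed.

(** The change of variables holds for the Radon-Nikodym derivative, and [f] agrees with it almost
    everywhere. The function [g] may take the value [+oo], as [tau] does. *)
Lemma integral_density (nu : {measure set T -> \bar R})
    (mu : {finite_measure set T -> \bar R}) (f : T -> R) (g : T -> \bar R)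
    (D : set T) : nu setT < +oo ->
  is_density nu mu f -> measurable D -> measurable_fun D g ->
  (forall x, 0 <= g x) ->
  \int[mu]_(x in D) g x = \int[nu]_(x in D) (g x * (f x)%:E).
Proof.
case/finite_measure_of => m <- df mD mg g0; have [mf f0 fE] := df.
have ac : null_dominates m mu.
  apply/null_content_dominatesP => A mA nuA0; rewrite fE//.
  by apply: null_set_integral => //; apply/measurable_EFinP/measurable_funTS.
rewrite -(Radon_Nikodym_SigmaFinite.change_of_variables ac)//.
have mh := measurable_int _ (Radon_Nikodym_SigmaFinite.f_integrable ac).
have := @density_ae_eq _ _ _ _ df mh (Radon_Nikodym_SigmaFinite.f_integral ac).
move=> fh; apply: ge0_ae_eq_integral => //.
- by apply: emeasurable_funM => //; exact: measurable_funTS.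
- apply: emeasurable_funM => //.
  by apply/measurable_EFinP/measurable_funTS.
- by move=> x _; rewrite mule_ge0// Radon_Nikodym_SigmaFinite.f_ge0.
- by move=> x _; rewrite mule_ge0// lee_fin.
- by apply: filterS fh => x /(_ I) /= -> _.
Qed.

End densities.

(** * Hoelder's inequality in logarithmic form, and powers of extended reals *)

Section hoelder_log.
Context {R : realType}.
Implicit Types s t c : R.

(** Young's inequality for [u] scaled by [expR ((1 - s) * t)] and [v] scaled by [expR (- s * t)]:
    the factors cancel in the product [a * b], which leaves [t] free. *)
Lemma young_powR s t (u v : R) : (0 < s < 1)%R -> (0 <= u)%R -> (0 <= v)%R ->
  (u `^ s * v `^ (1 - s) <=
   s * expR ((1 - s) * t) * u + (1 - s) * expR (- s * t) * v)%R.
Proof.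
move=> /andP[s0 s1] u0 v0; have s1' : (0 < 1 - s)%R by rewrite subr_gt0.
pose a := ((expR ((1 - s) * t) * u) `^ s)%R.
pose b := ((expR (- s * t) * v) `^ (1 - s))%R.
have -> : (u `^ s * v `^ (1 - s) = a * b)%R.
  rewrite /a /b !powRM ?expR_ge0// -!expRM mulrACA -expRD.
  by rewrite [X in expR X](_ : _ = 0)%R ?expR0 ?mul1r//; ring.
have := @conjugate_powR _ a b (s^-1)%R ((1 - s)^-1)%R (powR_ge0 _ _) (powR_ge0 _ _).
rewrite !invr_gt0 s0 s1' !invrK => /(_ isT isT); rewrite addrC subrK => /(_ erefl).
rewrite /a /b -!powRrM !divff ?gt_eqF// !powRr1 ?mulr_ge0 ?expR_ge0//.
by move=> /le_trans; apply; rewrite le_eqVlt; apply/orP; left; apply/eqP; ring.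
Qed.

(* Taking the infimum over [t] turns the linear bound into the geometric mean
   of [U] and [V]; for [U = 0] or [V = 0] the infimum is not attained. *)
Lemma eln_young s (W U V : \bar R) : (0 < s < 1)%R ->
  0 <= W -> 0 <= U -> 0 <= V ->
  (forall t, W <= (s * expR ((1 - s) * t))%:E * U +
                  ((1 - s) * expR (- s * t))%:E * V) ->
  eln W <= dual_adde (s%:E * eln U) ((1 - s)%:E * eln V).
Proof.
move=> /andP[s0 s1] W0; have s1' : (0 < 1 - s)%R by rewrite subr_gt0.
(* A positive [w] is impossible: [expR (l * t)] takes every positive value, and the [t] chosen below
   brings the right-hand side down to [w / 2]. *)
have scale0 (k l v w : R) : (0 < k)%R -> (l != 0)%R ->
    (forall t, w <= k * expR (l * t) * v)%R -> (w <= 0)%R.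
  move=> k0 l0 H; rewrite leNgt; apply/negP => w0.
  have v0 : (0 < v)%R.
    have := lt_le_trans w0 (H 0%R); rewrite pmulr_rgt0// mulr_gt0// expR_gt0//.
  have kv : (0 < 2 * (k * v))%R by rewrite !mulr_gt0.
  have := H (l^-1 * ln (w / (2 * (k * v))))%R.
  rewrite mulVKf// lnK ?posrE ?divr_gt0//.
  rewrite (_ : _ * _ * v = w / 2)%R; last by field; rewrite !gt_eqF//= (gt_eqF k0) gt_eqF.
  by rewrite leNgt ltr_pdivrMr// mulr_natr mulr2n ltrDl w0.
have ly : eln W <= +oo by rewrite leey.
case: U => [U||] //; last by move=> _ _ _; rewrite /= gt0_muley// lte_fin.
case: V => [V||] //; last first.
  move=> _ _ _; rewrite /= (gt0_muley (x := (1 - s)%:E)) ?lte_fin//.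
  by case: (_ * _).
rewrite !lee_fin => U0 V0 H.
have {H} : forall t, W <= (s * expR ((1 - s) * t) * U +
    (1 - s) * expR (- s * t) * V)%:E by [].
case: W W0 {ly} => [w||] //; last by move=> _ /(_ 0%R).
rewrite lee_fin => w0 H.
have weq0 : (w <= 0)%R -> eln w%:E = -oo.
  by move=> w0'; rewrite /= ltNge w0'.
move: U0; rewrite le_eqVlt => /predU1P[U0|U0].
  rewrite weq0 ?leNye//; apply: (scale0 (1 - s)%R (- s)%R V) => //.
    by rewrite oppr_eq0 gt_eqF.
  by move=> t; have := H t; rewrite -U0 mulr0 add0r lee_fin.
move: V0; rewrite le_eqVlt => /predU1P[V0|V0].
  rewrite weq0 ?leNye//; apply: (scale0 s (1 - s)%R U) => //.
    by rewrite gt_eqF.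
  by move=> t; have := H t; rewrite -V0 mulr0 addr0 lee_fin.
rewrite /= U0 V0 -!EFinM /dual_adde.
case: ifPn => [wgt0|_]; last by rewrite leNye.
rewrite lee_fin -ler_expR lnK ?posrE//.
(* The minimising [t]: each exponential times [U] or [V] becomes [U^s V^(1-s)], and the weights [s]
   and [1 - s] add up to 1. *)
have := H (ln V - ln U)%R; rewrite lee_fin => /le_trans; apply.
rewrite -[X in (_ * X + _)%R](lnK (x := U)) ?posrE//.
rewrite -[X in (_ + _ * X)%R](lnK (x := V)) ?posrE//.
rewrite -!mulrA -!expRD.
rewrite [X in (s * expR X)%R](_ : _ = s * ln U + (1 - s) * ln V)%R; last by ring.
rewrite [X in ((1 - s) * expR X)%R](_ : _ = s * ln U + (1 - s) * ln V)%R; last by ring.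
by rewrite -mulrDl [(s + _)%R]addrC subrK mul1r.
Qed.

(** The linear bound is integrated for each fixed [t] and optimised over [t] only afterwards.
    Assuming linear bounds instead of [w = u^s v^(1-s)] keeps powers of infinite values out of the
    argument. *)
Lemma eln_hoelder {d : measure_display} {T : measurableType d}
    (mu : {measure set T -> \bar R}) (D : set T) s (w u v : T -> \bar R) :
  measurable D -> (0 < s < 1)%R ->
  measurable_fun D w -> measurable_fun D u -> measurable_fun D v ->
  (forall x, D x -> [/\ 0 <= w x, 0 <= u x & 0 <= v x]) ->
  (forall x t, D x -> w x <= (s * expR ((1 - s) * t))%:E * u x +
                             ((1 - s) * expR (- s * t))%:E * v x) ->
  eln (\int[mu]_(x in D) w x) <=
  dual_adde (s%:E * eln (\int[mu]_(x in D) u x))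
            ((1 - s)%:E * eln (\int[mu]_(x in D) v x)).
Proof.
move=> mD s01 mw mu' mv pos wle; have /andP[s0 s1] := s01.
have w0 x : D x -> 0 <= w x by case/pos.
have u0 x : D x -> 0 <= u x by case/pos.
have v0 x : D x -> 0 <= v x by case/pos.
apply: eln_young => //; [exact: integral_ge0..|] => t.
have a0 : (0 <= s * expR ((1 - s) * t))%R by rewrite mulr_ge0 ?expR_ge0 ?ltW.
have b0 : (0 <= (1 - s) * expR (- s * t))%R.
  by rewrite mulr_ge0 ?expR_ge0 ?ltW ?subr_gt0.
rewrite -!ge0_integralZl// -ge0_integralD//.
- apply: ge0_le_integral => //; last by move=> x Dx; exact: wle.
  by apply: emeasurable_funD; exact: measurable_funeM.
- by move=> x Dx; rewrite mule_ge0 ?u0.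
- exact: measurable_funeM.
- by move=> x Dx; rewrite mule_ge0 ?v0.
- exact: measurable_funeM.
Qed.

Lemma epow_ge0 (x : \bar R) c : 0 <= epow x c.
Proof.
case: x => [r||] //=; last by do ?case: ifP.
by case: ifP => _; [rewrite lee_fin powR_ge0|do ?case: ifP].
Qed.

Lemma measurable_epow {d : measure_display} {T : measurableType d}
    (f : T -> \bar R) c :
  measurable_fun setT f -> measurable_fun setT (fun x => epow (f x) c).
Proof.
move=> mf.
pose k : \bar R :=
  if (0 < c)%R then 0 else if (c < 0)%R then +oo else 1.
rewrite (_ : (fun x => _) = fun x => if f x == +oo then epow +oo c
    else if f x == -oo then 0 else
    if 0 < f x then ((fine (f x)) `^ c)%:E else k); last first.
  by apply/funext => x; case: (f x) => //= r; rewrite lte_fin.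
apply: measurable_fun_ifT => //; first exact: measurable_fun_eqe.
apply: measurable_fun_ifT => //; first exact: measurable_fun_eqe.
apply: measurable_fun_ifT => //; first exact: measurable_fun_lte.
apply/measurable_EFinP; apply: (measurableT_comp (measurable_powR c)).
exact: measurableT_comp.
Qed.

End hoelder_log.

(** * Rearranging bounds under the two conventions for infinite differences *)

Section extended_arithmetic.
Context {R : realType}.
Implicit Types (c k : R) (x y z : \bar R).

Let gt0_y k : (0 < k)%R -> (k%:E * +oo = +oo) * (k%:E * -oo = -oo) :> Type.
Proof. by move=> k0; rewrite gt0_muley ?gt0_muleNy ?lte_fin. Qed.

Let lt0_y k : (k < 0)%R -> (k%:E * +oo = -oo) * (k%:E * -oo = +oo) :> Type.
Proof. by move=> k0; rewrite lt0_muley ?lt0_muleNy ?lte_fin. Qed.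

Lemma dual_addey x : dual_adde x +oo = +oo.
Proof. by case: x. Qed.

(** Solves the Hoelder bound for [y]. Since [dual_adde] sends [+oo - oo] to [+oo] and the ordinary
    sum sends it to [-oo], every case with an infinite value goes through. *)
Lemma dual_adde_leBl c x y z : (0 < c < 1)%R ->
  x <= dual_adde (c%:E * y) ((1 - c)%:E * z) ->
  (c^-1)%:E * x - ((1 - c) / c)%:E * z <= y.
Proof.
move=> /andP[c0 c1]; have c1' : (0 < 1 - c)%R by rewrite subr_gt0.
have ci : (0 < c^-1)%R by rewrite invr_gt0.
have cd : (0 < (1 - c) / c)%R by rewrite divr_gt0.
have [e1 e1'] := gt0_y c0; have [e2 e2'] := gt0_y c1'.
have [e3 e3'] := gt0_y ci; have [e4 e4'] := gt0_y cd.
case: x => [x||]; case: y => [y||]; case: z => [z||];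
  rewrite ?(e1, e1', e2, e2', e3, e3', e4, e4') /dual_adde ?leey ?leNye//=.
rewrite -!EFinM !lee_fin => H.
rewrite -(ler_pM2l c0) mulrBr mulVKf ?gt_eqF//.
rewrite (_ : c * ((1 - c) / c * z) = (1 - c) * z)%R ?lerBlDr//.
by field; rewrite gt_eqF.
Qed.

(** Here the bound is solved for [z]: division by the weight [1 - (1 - c)^-1 = - c / (1 - c)] turns
    the coefficient of [y] into [1 / c]. *)
Lemma dual_adde_leBr c x y z : (c < 0)%R ->
  x <= dual_adde (((1 - c)^-1)%:E * y) ((1 - (1 - c)^-1)%:E * z) ->
  (c^-1)%:E * y - ((1 - c) / c)%:E * x <= z.
Proof.
move=> c0; have c1 : (0 < 1 - c)%R by rewrite subr_gt0 (lt_trans c0).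
have a0 : (0 < (1 - c)^-1)%R by rewrite invr_gt0.
have aE : (1 - (1 - c)^-1 = - c / (1 - c))%R by field; rewrite gt_eqF.
have a1 : (0 < 1 - (1 - c)^-1)%R by rewrite aE divr_gt0// oppr_gt0.
have ci : (c^-1 < 0)%R by rewrite invr_lt0.
have cd : ((1 - c) / c < 0)%R by rewrite pmulr_rlt0.
have [e1 e1'] := gt0_y a0; have [e2 e2'] := gt0_y a1.
have [e3 e3'] := lt0_y ci; have [e4 e4'] := lt0_y cd.
case: x => [x||]; case: y => [y||]; case: z => [z||];
  rewrite ?(e1, e1', e2, e2', e3, e3', e4, e4') /dual_adde ?leey ?leNye//=.
rewrite -!EFinM !lee_fin => H.
have k0 : (0 < (1 - c) / - c)%R by rewrite divr_gt0// oppr_gt0.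
have := H; rewrite -(ler_pM2l k0) => {}H.
rewrite -subr_ge0; move: H; rewrite -subr_ge0 => H.
rewrite (_ : _ - _ = (1 - c) / - c * ((1 - c)^-1 * y + (1 - (1 - c)^-1) * z) -
  (1 - c) / - c * x)%R//.
by field; rewrite (gt_eqF c1) lt_eqF.
Qed.

Lemma le_dual_addeZ k x y z : (0 < k)%R -> y <= z ->
  dual_adde x (k%:E * y) <= dual_adde x (k%:E * z).
Proof.
move=> k0; have [e e'] := gt0_y k0.
case: x => [x||]; case: y => [y||]; case: z => [z||];
  rewrite ?(e, e') /dual_adde ?leey ?leNye//=.
by rewrite !lee_fin => yz; rewrite lerD2l ler_pM2l.
Qed.

Lemma le_subeZ k x y z : (0 < k)%R -> y <= z ->
  x - k%:E * z <= x - k%:E * y.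
Proof.
by move=> k0 yz; rewrite leeD2l// leeN2 lee_pmul2l ?lte_fin.
Qed.

Lemma eln_scale (k : R) (x : \bar R) : (0 < k)%R -> 0 <= x ->
  eln (x * k%:E) = eln x + (ln k)%:E.
Proof.
move=> k0; case: x => [x||] //= x0; last by rewrite muleC gt0_muley.
rewrite pmulr_lgt0//; case: ifPn => // xgt0.
by rewrite lnM ?posrE.
Qed.

End extended_arithmetic.

(** * The three pointwise factorisations and the Hoelder bounds they give *)

Section hoelder_bounds.
Context {d : measure_display} {T : measurableType d} {R : realType}.
Variables (nu : {measure set T -> \bar R}) (P Q : probability T R).
Variables (p q : T -> R) (tau : T -> \bar R).
Hypotheses (nuoo : nu setT < +oo) (dp : is_density nu P p)
  (dq : is_density nu Q q).
Hypotheses (mtau : measurable_fun setT tau) (tau0 : forall x, 0 <= tau x).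

Let mp : measurable_fun setT p. Proof. by case: dp. Qed.
Let p0 x : (0 <= p x)%R. Proof. by case: dp. Qed.
Let mq : measurable_fun setT q. Proof. by case: dq. Qed.
Let q0 x : (0 <= q x)%R. Proof. by case: dq. Qed.

Lemma measurable_density_support (f : T -> R) : measurable_fun setT f ->
  measurable [set x | (0 < f x)%R].
Proof.
move=> mf; rewrite (_ : [set x | _] = setT `&` [set x | 0 < (f x)%:E]).
  by apply: measurable_lte => //; exact/measurable_EFinP.
by rewrite setTI; apply/seteqP; split => x /=; rewrite lte_fin.
Qed.

Lemma density_support (mu : {measure set T -> \bar R}) (f : T -> R) :
  is_density nu mu f -> mu (~` [set x | (0 < f x)%R]) = 0.
Proof.
move=> [mf f0 fE]; rewrite fE; last first.
  exact/measurableC/measurable_density_support.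
apply: integral0_eq => x /= /negP; rewrite -leNgt => fx0.
by congr _%:E; apply/le_anti; rewrite fx0 f0.
Qed.

Lemma integral_full_set (mu : {measure set T -> \bar R}) (D : set T)
    (f : T -> \bar R) : measurable D -> mu (~` D) = 0 ->
  measurable_fun setT f -> (forall x, 0 <= f x) ->
  \int[mu]_(x in D) f x = \int[mu]_x f x.
Proof.
move=> mD D0 mf f0.
rewrite [RHS](ge0_negligible_integral (N := ~` D))//; last exact: measurableC.
by rewrite setTD setCK.
Qed.

Lemma measurable_powRM (f g : T -> R) (a b : R) :
  measurable_fun setT f -> measurable_fun setT g ->
  measurable_fun setT (fun x => (f x `^ a * g x `^ b)%:E).
Proof.
move=> mf mg; apply/measurable_EFinP; apply: measurable_funM.
  exact: (measurableT_comp (measurable_powR a)).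
exact: (measurableT_comp (measurable_powR b)).
Qed.

(* For [b < 0] this relies on the junk value [0 `^ b = 0]. *)
Lemma integral_powRM_support (f g : T -> R) (a b : R) : (b != 0)%R ->
  (forall x, 0 <= g x)%R ->
  \int[nu]_(x in [set x | (0 < g x)%R]) (f x `^ a * g x `^ b)%:E =
  \int[nu]_x (f x `^ a * g x `^ b)%:E.
Proof.
move=> b0 g0; rewrite integral_mkcond; apply: eq_integral => x _.
rewrite patchE; case: ifPn => //; rewrite notin_setE/= => /negP.
rewrite -leNgt => gx; have -> : g x = 0%R by apply/le_anti; rewrite gx g0.
by rewrite powR0// mulr0.
Qed.

Let mtaup c : measurable_fun setT (fun x => epow (tau x) c * (p x)%:E).
Proof.
by apply: emeasurable_funM; [exact: measurable_epow|exact/measurable_EFinP].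
Qed.

Let mtauq : measurable_fun setT (fun x => tau x * (q x)%:E).
Proof. by apply: emeasurable_funM => //; exact/measurable_EFinP. Qed.

(** Everything is restricted to [p > 0], where the negative power of [p] is genuine; [abs_cont Q P]
    ensures that no mass of [Q] is lost. There [tau q] factors into [tau^c p] and [q^a p^(1-a)] with
    weights [1/c] and [1 - 1/c]. *)
Lemma eln_integral_upper (c : R) : (1 < c)%R -> abs_cont Q P ->
  eln (\int[Q]_x tau x) <=
  dual_adde ((c^-1)%:E * eln (\int[P]_x epow (tau x) c))
    ((1 - c^-1)%:E *
     eln (\int[nu]_x (q x `^ (c / (c - 1)) * p x `^ (1 - c / (c - 1)))%:E)).
Proof.
move=> c1 ac; have c0 : (0 < c)%R by exact: lt_trans c1.
have c1' : (0 < c - 1)%R by rewrite subr_gt0.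
have aE : (1 - c / (c - 1) = - (c - 1)^-1)%R by field; rewrite gt_eqF.
pose D := [set x | (0 < p x)%R].
have mD : measurable D by exact: measurable_density_support.
have PD : P (~` D) = 0 by exact: density_support dp.
have QD : Q (~` D) = 0 by apply: ac => //; exact: measurableC.
rewrite -(integral_full_set _ QD)// -(integral_full_set (mu := P) _ PD)//;
  [|exact: measurable_epow|by move=> ?; exact: epow_ge0].
rewrite (integral_density nuoo dq)//; last exact: measurable_funTS.
rewrite (integral_density nuoo dp)//;
  [|by apply/measurable_funTS/measurable_epow|by move=> ?; exact: epow_ge0].
rewrite -integral_powRM_support//; last by rewrite aE oppr_eq0 invr_neq0 ?gt_eqF.
apply: eln_hoelder => //.
- by rewrite invr_gt0 c0 invf_lt1.
- exact: measurable_funTS.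
- exact: measurable_funTS.
- exact/measurable_funTS/measurable_powRM.
- by move=> x Dx; rewrite !mule_ge0 ?epow_ge0 ?lee_fin ?mulr_ge0 ?powR_ge0.
move=> x t; rewrite /D/= => px.
have k1 : (0 < c^-1 * expR ((1 - c^-1) * t))%R by rewrite mulr_gt0 ?expR_gt0 ?invr_gt0.
have k2 : (0 <= (1 - c^-1) * expR (- c^-1 * t))%R.
  by rewrite mulr_ge0 ?expR_ge0// subr_ge0 invf_le1// ltW.
have v0 : (0 <= q x `^ (c / (c - 1)) * p x `^ (1 - c / (c - 1)))%R.
  by rewrite mulr_ge0 ?powR_ge0.
(* Boundary values of [tau]: at [+oo] the first term on the right is [+oo] because [p x > 0]; at 0
   the left-hand side vanishes. *)
have := tau0 x; case: (tau x) => [r||] //=; last first.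
  rewrite c0 [X in _ * X + _]gt0_mulye ?lte_fin// gt0_muley ?lte_fin//.
  by rewrite addye ?leey.
rewrite lee_fin le_eqVlt => /predU1P[<-|r0].
  by rewrite ltxx c0 !mul0e mule0 add0e mule_ge0 ?lee_fin.
rewrite r0 -!EFinM -EFinD lee_fin.
have -> : (r * q x = (r `^ c * p x) `^ c^-1 *
    (q x `^ (c / (c - 1)) * p x `^ (1 - c / (c - 1))) `^ (1 - c^-1))%R.
  rewrite !powRM ?powR_ge0// -!powRrM divff ?gt_eqF// powRr1 ?(ltW r0)//.
  rewrite (_ : c / (c - 1) * (1 - c^-1) = 1)%R; last by field; rewrite !gt_eqF.
  rewrite (_ : (1 - c / (c - 1)) * (1 - c^-1) = - c^-1)%R; last by field; rewrite !gt_eqF.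
  rewrite powRr1// powRN; field.
  by rewrite powR_eq0 negb_and gt_eqF.
apply: young_powR => //; first by rewrite invr_gt0 c0 invf_lt1.
by rewrite mulr_ge0 ?powR_ge0.
Qed.

(** The negative power now falls on [q], so the restriction is to [q > 0] and [abs_cont P Q] keeps
    the mass of [P]. *)
Lemma eln_integral_lower_pos (c : R) : (0 < c < 1)%R -> abs_cont P Q ->
  eln (\int[P]_x epow (tau x) c) <=
  dual_adde (c%:E * eln (\int[Q]_x tau x))
    ((1 - c)%:E *
     eln (\int[nu]_x (p x `^ (1 - c)^-1 * q x `^ (1 - (1 - c)^-1))%:E)).
Proof.
move=> c01 ac; have /andP[c0 c1] := c01.
have c1' : (0 < 1 - c)%R by rewrite subr_gt0.
have aE : (1 - (1 - c)^-1 = - c / (1 - c))%R by field; rewrite gt_eqF.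
pose D := [set x | (0 < q x)%R].
have mD : measurable D by exact: measurable_density_support.
have QD : Q (~` D) = 0 by exact: density_support dq.
have PD : P (~` D) = 0 by apply: ac => //; exact: measurableC.
rewrite -(integral_full_set _ QD)// -(integral_full_set (mu := P) _ PD)//;
  [|exact: measurable_epow|by move=> ?; exact: epow_ge0].
rewrite (integral_density nuoo dq)//; last exact: measurable_funTS.
rewrite (integral_density nuoo dp)//;
  [|by apply/measurable_funTS/measurable_epow|by move=> ?; exact: epow_ge0].
rewrite -integral_powRM_support//; last first.
  by rewrite aE mulNr oppr_eq0 mulf_neq0 ?invr_neq0 ?gt_eqF.
apply: eln_hoelder => //.
- exact: measurable_funTS.
- exact: measurable_funTS.
- exact/measurable_funTS/measurable_powRM.
- by move=> x Dx; rewrite !mule_ge0 ?epow_ge0 ?lee_fin ?mulr_ge0 ?powR_ge0.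
move=> x t; rewrite /D/= => qx.
have k1 : (0 < c * expR ((1 - c) * t))%R by rewrite mulr_gt0 ?expR_gt0.
have k2 : (0 <= (1 - c) * expR (- c * t))%R by rewrite mulr_ge0 ?expR_ge0 ?ltW.
have v0 : (0 <= p x `^ (1 - c)^-1 * q x `^ (1 - (1 - c)^-1))%R.
  by rewrite mulr_ge0 ?powR_ge0.
have := tau0 x; case: (tau x) => [r||] //=; last first.
  rewrite c0 [X in _ * X + _]gt0_mulye ?lte_fin//.
  by rewrite [X in _ <= X + _]gt0_muley ?lte_fin// addye ?leey.
rewrite lee_fin le_eqVlt => /predU1P[<-|r0].
  by rewrite ltxx c0 !mul0e mule0 add0e mule_ge0 ?lee_fin.
rewrite r0 -!EFinM -EFinD lee_fin.
have -> : (r `^ c * p x = (r * q x) `^ c *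
    (p x `^ (1 - c)^-1 * q x `^ (1 - (1 - c)^-1)) `^ (1 - c))%R.
  rewrite !powRM ?powR_ge0 ?(ltW r0)// -!powRrM mulVf ?gt_eqF// powRr1//.
  rewrite aE (_ : - c / (1 - c) * (1 - c) = - c)%R; last first.
    by rewrite divfK ?gt_eqF.
  by rewrite powRN; field; rewrite powR_eq0 negb_and gt_eqF.
by apply: young_powR => //; rewrite mulr_ge0 // ltW.
Qed.

(** For [c < 0] the order [a = (1 - c)^-1] lies strictly between 0 and 1, and it is the Renyi
    integrand that is factored: the powers of [tau] cancel because [c a + (1 - a) = 0]. *)
Lemma eln_integral_lower_neg (c : R) : (c < 0)%R ->
  eln (\int[nu]_x (p x `^ (1 - c)^-1 * q x `^ (1 - (1 - c)^-1))%:E) <=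
  dual_adde (((1 - c)^-1)%:E * eln (\int[P]_x epow (tau x) c))
    ((1 - (1 - c)^-1)%:E * eln (\int[Q]_x tau x)).
Proof.
move=> c0; have c1 : (1 < 1 - c)%R by rewrite ltrBrDr gtrDl.
have c1' : (0 < 1 - c)%R by exact: lt_trans c1.
have ca : (c * (1 - c)^-1 + (1 - (1 - c)^-1) = 0)%R by field; rewrite gt_eqF.
have a01 : (0 < (1 - c)^-1 < 1)%R by rewrite invr_gt0 c1' invf_lt1.
have a1 : (0 < 1 - (1 - c)^-1)%R by rewrite subr_gt0; case/andP: a01.
rewrite (integral_density nuoo dq)//.
rewrite (integral_density nuoo dp)//;
  [|exact: measurable_epow|by move=> ?; exact: epow_ge0].
apply: eln_hoelder => //; first exact: measurable_powRM.
  by move=> x _; rewrite !mule_ge0 ?epow_ge0 ?lee_fin ?mulr_ge0 ?powR_ge0.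
move=> x t _; move: (1 - c)^-1%R ca a01 a1 => a ca /andP[a0 a1] a1'.
have k1 : (0 < a * expR ((1 - a) * t))%R by rewrite mulr_gt0 ?expR_gt0.
have k2 : (0 < (1 - a) * expR (- a * t))%R by rewrite mulr_gt0 ?expR_gt0.
(* Where [p] or [q] vanishes, so does the left-hand side, both exponents being positive. *)
have := p0 x; rewrite le_eqVlt => /predU1P[<-|px].
  rewrite powR0 ?gt_eqF// mul0r adde_ge0// !mule_ge0 ?lee_fin ?(ltW k1) ?(ltW k2)//.
  exact: epow_ge0.
have := q0 x; rewrite le_eqVlt => /predU1P[<-|qx].
  rewrite [X in (_ * X)%R]powR0 ?gt_eqF// mulr0 adde_ge0//.
    by rewrite !mule_ge0 ?epow_ge0 ?lee_fin ?(ltW k1) ?(ltW px).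
  by rewrite !mule_ge0 ?lee_fin ?(ltW k2).
(* For positive [p] and [q], an extreme [tau] makes one term infinite: [tau q] at [+oo], and
   [tau^c p] at 0 since [c < 0]. *)
have := tau0 x; case: (tau x) => [r||] //=; last first.
  rewrite ltNge (ltW c0)/= c0 mul0e mule0 add0e gt0_mulye ?lte_fin//.
  by rewrite gt0_muley ?lte_fin ?leey.
rewrite lee_fin le_eqVlt => /predU1P[<-|r0].
  rewrite ltxx ltNge (ltW c0)/= c0 gt0_mulye ?lte_fin// gt0_muley ?lte_fin//.
  by rewrite mul0e mule0 addye ?leey.
rewrite r0 -!EFinM -EFinD lee_fin.
have -> : (p x `^ a * q x `^ (1 - a) =
    (r `^ c * p x) `^ a * (r * q x) `^ (1 - a))%R.
  rewrite !powRM ?powR_ge0 ?(ltW r0)// mulrACA -powRrM -powRD; last first.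
    by rewrite (gt_eqF r0) implybT.
  by rewrite ca powRr0 mul1r.
by apply: young_powR; rewrite ?a0 ?mulr_ge0 ?powR_ge0 ?(ltW r0).
Qed.

End hoelder_bounds.

(** * Renyi divergences through Hellinger integrals, and the bounds for arbitrary [Q] *)

Section renyi_integral.
Context {d : measure_display} {T : measurableType d} {R : realType}.
Implicit Types (P Q : probability T R) (alpha c : R).

(** The Hellinger integral of order [alpha], taken over the whole space so that it is symmetric
    under exchanging the measures together with [alpha] and [1 - alpha]. For [alpha != 1] the set
    [p = 0] contributes nothing, as [powR] sends 0 to 0 for nonzero exponents. *)
Definition renyi_integral alpha Q P : \bar R :=
  \int[measure_add P Q]_x
    ((density (measure_add P Q) Q x) `^ alpha *
     (density (measure_add P Q) P x) `^ (1 - alpha))%:E.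

Lemma renyi_integralC alpha P Q :
  renyi_integral (1 - alpha) P Q = renyi_integral alpha Q P.
Proof.
rewrite /renyi_integral (measure_addC Q P).
rewrite (eq_measure_integral (measure_add P Q)) => [|A _ _].
  by apply: eq_integral => x _; rewrite subKr mulrC.
rewrite -[LHS]/(measure_add Q P A) -[RHS]/(measure_add P Q A).
by rewrite !measure_addE addeC.
Qed.

Lemma renyi_posE alpha Q P : (alpha != 1)%R ->
  renyi_pos alpha Q P =
  if (1 < alpha)%R && ~~ `[< abs_cont Q P >] then +oo
  else ((alpha * (alpha - 1))^-1)%:E * eln (renyi_integral alpha Q P).
Proof.
move=> a1; rewrite /renyi_pos; case: ifP => // _; congr (_ * eln _).
rewrite integral_powRM_support//; first by rewrite subr_eq0 eq_sym.
by case: (density_addl P Q).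
Qed.

(** The prefactor is invariant under [alpha -> 1 - alpha], and with both orders below 1 the test of
    absolute continuity does not fire. *)
Lemma renyi_posC alpha Q P : (0 < alpha < 1)%R ->
  renyi_pos alpha Q P = renyi_pos (1 - alpha) P Q.
Proof.
move=> /andP[a0 a1]; rewrite !renyi_posE ?lt_eqF//; last by rewrite gtrBl.
rewrite !ltNge (ltW a1) lerBlDr lerDl (ltW a0)/= renyi_integralC.
by congr ((_^-1)%:E * _); ring.
Qed.

Lemma renyi_pos_upper c Q P (tau : T -> \bar R) :
  measurable_fun setT tau -> (forall x, 0 <= tau x) -> (1 < c)%R ->
  eln (\int[Q]_x tau x) <=
  dual_adde ((c^-1)%:E * eln (\int[P]_x epow (tau x) c))
    (((c - 1)^-1)%:E * renyi_pos (c / (c - 1)) Q P).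
Proof.
move=> mtau tau0 c1; have c1' : (0 < c - 1)%R by rewrite subr_gt0.
have c0 : (0 < c)%R by exact: lt_trans c1.
have a1 : (1 < c / (c - 1))%R by rewrite ltr_pdivlMr// mul1r gtrBl.
rewrite renyi_posE ?gt_eqF// a1/=; case: asboolP => [ac|_] /=; last first.
  by rewrite gt0_muley ?lte_fin ?invr_gt0// dual_addey leey.
(* With [a = c / (c - 1)], the two prefactors multiply to [1 / ((c - 1) a (a - 1)) = 1 - 1/c], the
   Hoelder weight. *)
rewrite muleA -EFinM (_ : (_ * _ = 1 - c^-1)%R).
  apply: eln_integral_upper => //; [exact: measure_addT| |].
    exact: density_addl.
  exact: density_addr.
field; rewrite !gt_eqF//=.
by rewrite mulN1r opprB addrC subrK ltr01.
Qed.

Lemma renyi_pos_lower c Q P (tau : T -> \bar R) :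
  measurable_fun setT tau -> (forall x, 0 <= tau x) -> (c < 1)%R ->
  (c != 0)%R ->
  (c^-1)%:E * eln (\int[P]_x epow (tau x) c) -
    ((1 - c)^-1)%:E * renyi_pos (1 - c)^-1 P Q <= eln (\int[Q]_x tau x).
Proof.
move=> mtau tau0 c1 c0; have c1' : (0 < 1 - c)%R by rewrite subr_gt0.
have a1 : ((1 - c)^-1 != 1)%R.
  by rewrite invr_eq1 -subr_eq0 addrAC subrr add0r oppr_eq0.
have coef : ((1 - c)^-1 * ((1 - c)^-1 * ((1 - c)^-1 - 1))^-1 = (1 - c) / c)%R.
  by field; rewrite c0 gt_eqF.
rewrite renyi_posE//; case: ifPn => [_|].
  by rewrite gt0_muley ?lte_fin ?invr_gt0// addeNy leNye.
move=> /nandP ac; rewrite muleA -EFinM coef.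
have [cpos|cneg|ceq] := ltgtP 0%R c; last by rewrite -ceq eqxx in c0.
- apply: dual_adde_leBl; first by rewrite cpos.
  apply: eln_integral_lower_pos => //; [exact: measure_addT| | | |].
  + exact: density_addr.
  + exact: density_addl.
  + by rewrite cpos.
  (* For [0 < c] the order [(1 - c)^-1] exceeds 1, so being outside the [+oo] branch of the
     definition means [abs_cont P Q]. *)
  + by case: ac => [|/negPn/asboolP//]; rewrite invf_gt1// gtrBl cpos.
- apply: dual_adde_leBr => //.
  apply: eln_integral_lower_neg => //; first exact: measure_addT.
    exact: density_addr.
  exact: density_addl.
Qed.

(** If [dQ = h dP], then [q = h p] almost everywhere, so [q^alpha p^(1 - alpha) = h^alpha p]; where
    [p = 0] this uses [alpha != 0]. *)
Lemma renyi_integral_density alpha P Q (h : T -> R) : (alpha != 0)%R ->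
  is_density P Q h -> renyi_integral alpha Q P = \int[P]_x (h x `^ alpha)%:E.
Proof.
move=> a0 dh; have [mh h0 hE] := dh.
have nuoo := measure_addT P Q; have dp := density_addl P Q.
have dq := density_addr P Q; have [mp p0 _] := dp; have [mq q0 _] := dq.
rewrite /renyi_integral; move: (density _ P) (density _ Q) dp dq mp p0 mq q0.
move=> p q dp dq mp p0 mq q0.
have mha : measurable_fun setT (fun x => (h x `^ alpha)%:E).
  by apply/measurable_EFinP; exact: (measurableT_comp (measurable_powR alpha)).
rewrite (integral_density nuoo dp)//; last by move=> x; rewrite lee_fin powR_ge0.
apply: ge0_ae_eq_integral => //.
- exact: measurable_powRM.
- by apply: emeasurable_funM => //; exact/measurable_EFinP.
- by move=> x _; rewrite lee_fin mulr_ge0 ?powR_ge0.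
- by move=> x _; rewrite mule_ge0 ?lee_fin ?powR_ge0.
have mhp : measurable_fun setT (fun x => (h x)%:E * (p x)%:E).
  by apply: emeasurable_funM; exact/measurable_EFinP.
have := @density_ae_eq _ _ _ _ Q q _ dq mhp.
have hpE A : measurable A ->
    Q A = \int[measure_add P Q]_(x in A) ((h x)%:E * (p x)%:E).
  move=> mA; rewrite -(integral_density (g := fun x => (h x)%:E) nuoo dp)//.
  - exact: hE.
  - exact/measurable_funTS/measurable_EFinP.
move=> /(_ hpE); apply: filterS => x /(_ I) /= -[->] _.
rewrite -EFinM; congr (_%:E).
have := p0 x; rewrite le_eqVlt => /predU1P[<-|px].
  by rewrite !mulr0 powR0// mul0r.
rewrite powRM// -mulrA -powRD; last by rewrite (gt_eqF px) implybT.
by rewrite addrC subrK powRr1// ltW.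
Qed.

End renyi_integral.

(** * The tilted measure [Qg]: its density, moments and divergences *)

Section tilted_measure.
Context {d : measure_display} {T : measurableType d} {R : realType}.
Variables (P Qg : probability T R) (tau : T -> \bar R) (gamma : R).
Hypotheses (mtau : measurable_fun setT tau) (tau0 : forall x, 0 <= tau x).
Hypotheses (gamma0 : (gamma != 0)%R) (gammaN1 : (gamma != -1)%R).
Hypothesis momentP : 0 < \int[P]_x epow (tau x) gamma < +oo.
Hypothesis QgE : forall A, measurable A ->
  Qg A = (\int[P]_(x in A) epow (tau x) gamma) *
         ((fine (\int[P]_x epow (tau x) gamma))^-1)%:E.
Hypothesis tau_fin : (-1 < gamma)%R -> (gamma < 0)%R ->
  {ae P, forall x, tau x < +oo}.

Local Notation Z := (fine (\int[P]_x epow (tau x) gamma)).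
Local Notation A := (\int[P]_x epow (tau x) (gamma + 1)).
Local Notation beta := (1 + gamma^-1)%R.
Local Notation h := (fun x => fine (epow (tau x) gamma) / Z)%R.

Let gamma1 : (gamma + 1 != 0)%R.
Proof. by rewrite addr_eq0. Qed.

Let b0 : (beta != 0)%R.
Proof.
rewrite (_ : beta = ((gamma + 1) / gamma)%R); last by field.
by rewrite mulf_neq0 ?invr_neq0.
Qed.

Let Z_gt0 : (0 < Z)%R.
Proof. by rewrite fine_gt0. Qed.

Let mepow c : measurable_fun setT (fun x => epow (tau x) c).
Proof. exact: measurable_epow. Qed.

Let epow_fin : \forall x \ae P, epow (tau x) gamma < +oo.
Proof.
have : P.-integrable setT (fun x => epow (tau x) gamma).
  apply/integrableP; split => //.
  under eq_integral do rewrite gee0_abs ?epow_ge0//.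
  by case/andP: momentP.
move=> /(integrable_ae measurableT); apply: filterS => x /(_ I).
by rewrite fin_num_abs => /(le_lt_trans (lee_abs _)).
Qed.

(** The second identity is where [beta] comes from: [gamma * beta = gamma + 1]. The hypotheses
    exclude [+oo] for [gamma > 0] and 0 for [gamma < 0], where the power is infinite, and [+oo] for
    [-1 < gamma < 0], where [+oo] would face [+oo * 0 = 0]. *)
Lemma epow_exponentS (t : \bar R) : 0 <= t -> epow t gamma < +oo ->
  ((-1 < gamma)%R -> (gamma < 0)%R -> t < +oo) ->
  epow t (gamma + 1) = t * (fine (epow t gamma))%:E /\
  epow t (gamma + 1) = (fine (epow t gamma) `^ beta)%:E.
Proof.
have [g0|g0|g0] := ltgtP gamma 0%R; last by have := gamma0; rewrite g0 eqxx.
- have ng : (0 < gamma)%R = false by rewrite ltNge ltW.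
  (* The value [+oo] survives only for [gamma < -1], where both powers are 0. *)
  case: t => [r||] //=; last first.
    rewrite ng => _ _ H.
    have g1 : (gamma < -1)%R.
      by rewrite lt_neqAle gammaN1 leNgt; apply/negP => /H /(_ erefl).
    have g1' : (gamma + 1 < 0)%R by rewrite -ltrBrDr sub0r.
    by rewrite ltNge (ltW g1')/= g1' g0/= mule0 powR0.
  rewrite lee_fin le_eqVlt => /predU1P[<-|r0].
    by rewrite ltxx ng g0.
  rewrite r0 => _ _ /=; rewrite -EFinM; split; congr (_%:E).
    by rewrite addrC powRD ?powRr1 ?(ltW r0)// (gt_eqF r0) implybT.
  by rewrite -powRrM mulrDr mulr1 divff.
- have g1 : (0 < gamma + 1)%R by rewrite addr_gt0.
  case: t => [r||] //=; last by rewrite g0.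
  rewrite lee_fin le_eqVlt => /predU1P[<-|r0].
    by rewrite ltxx g0 g1 mul0e powR0.
  rewrite r0 => _ _ /=; rewrite -EFinM; split; congr (_%:E).
    by rewrite addrC powRD ?powRr1 ?(ltW r0)// (gt_eqF r0) implybT.
  by rewrite -powRrM mulrDr mulr1 divff.
Qed.

Let epow_ae : \forall x \ae P,
  epow (tau x) (gamma + 1) = tau x * (fine (epow (tau x) gamma))%:E /\
  epow (tau x) (gamma + 1) = (fine (epow (tau x) gamma) `^ beta)%:E.
Proof.
have H : \forall x \ae P, (-1 < gamma)%R -> (gamma < 0)%R -> tau x < +oo.
  have [g1|g1] := ltP (-1)%R gamma; last by apply: aeW.
  have [g0|g0] := ltP gamma 0%R; last by apply: aeW.
  by have := tau_fin g1 g0; apply: filterS.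
by apply: filterS2 epow_fin H => x ? ?; exact: epow_exponentS.
Qed.

Let mh : measurable_fun setT h.
Proof.
by apply: measurable_funM => //; exact: measurableT_comp.
Qed.

Let h_ge0 x : (0 <= h x)%R.
Proof. by apply: divr_ge0; [rewrite fine_ge0 ?epow_ge0|exact: ltW]. Qed.

Lemma tilted_density : is_density P Qg h.
Proof.
split => // B mB.
apply: etrans (QgE mB) _.
rewrite muleC -ge0_integralZl//; last 3 first.
- exact: measurable_funTS.
- by move=> x _; exact: epow_ge0.
- by rewrite lee_fin invr_ge0 (ltW Z_gt0).
apply: ge0_ae_eq_integral => //.
- by apply: measurable_funeM; exact: measurable_funTS.
- exact/measurable_EFinP/measurable_funTS.
- by move=> x _; rewrite mule_ge0 ?epow_ge0// lee_fin invr_ge0 (ltW Z_gt0).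
- by move=> x _; rewrite lee_fin.
apply: filterS epow_fin => x fx _.
by rewrite EFinM fineK ?ge0_fin_numE ?epow_ge0// muleC.
Qed.

Lemma integral_tilted : \int[Qg]_x tau x = A * (Z^-1)%:E.
Proof.
have Poo : P setT < +oo.
  exact: le_lt_trans (probability_le1 P measurableT) (ltry 1).
rewrite (integral_density Poo tilted_density)// [RHS]muleC -ge0_integralZl//.
- apply: ge0_ae_eq_integral => //.
  + by apply: emeasurable_funM => //; exact/measurable_EFinP.
  + exact: measurable_funeM.
  + by move=> x _; rewrite mule_ge0 ?lee_fin.
  + by move=> x _; rewrite mule_ge0 ?epow_ge0// lee_fin invr_ge0 (ltW Z_gt0).
  + by apply: filterS epow_ae => x [-> _] _; rewrite EFinM muleA muleC.
- by move=> x _; exact: epow_ge0.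
- by rewrite lee_fin invr_ge0 (ltW Z_gt0).
Qed.

(** Almost everywhere [h^beta = tau^(gamma + 1) Z^(- beta)]: at order [beta] the divergence is
    governed by the same moment [A] as the mean of [tau] under [Qg]. *)
Lemma renyi_integral_tilted :
  renyi_integral beta Qg P = A * (Z `^ (- beta))%:E.
Proof.
rewrite (renyi_integral_density b0 tilted_density) [RHS]muleC -ge0_integralZl//.
- apply: ge0_ae_eq_integral => //.
  + by apply/measurable_EFinP; exact: (measurableT_comp (measurable_powR beta)).
  + exact: measurable_funeM.
  + by move=> x _; rewrite lee_fin powR_ge0.
  + by move=> x _; rewrite mule_ge0 ?epow_ge0// lee_fin powR_ge0.
  + apply: filterS epow_ae => x [_ ->] _; rewrite powRM.
    * by rewrite -[(Z^-1)%R]powR_inv1 ?(ltW Z_gt0)// -powRrM mulN1r EFinM muleC.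
    * by rewrite fine_ge0 ?epow_ge0.
    * by rewrite invr_ge0 (ltW Z_gt0).
- by move=> x _; exact: epow_ge0.
- by rewrite lee_fin powR_ge0.
Qed.

Let A_ge0 : 0 <= A.
Proof. by apply: integral_ge0 => x _; exact: epow_ge0. Qed.

Lemma eln_integral_tilted : eln (\int[Qg]_x tau x) = eln A - (ln Z)%:E.
Proof.
by rewrite integral_tilted eln_scale ?invr_gt0// lnV ?posrE// EFinN.
Qed.

Lemma eln_renyi_integral_tilted :
  eln (renyi_integral beta Qg P) = eln A - (beta * ln Z)%:E.
Proof.
by rewrite renyi_integral_tilted eln_scale ?powR_gt0// ln_powR mulNr EFinN.
Qed.

(** If [A = 0], then [(tau^gamma)^beta], and hence [tau^gamma], vanishes almost everywhere, against
    [momentP]. *)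
Lemma moment_gt0 : 0 < A.
Proof.
rewrite lt0e A_ge0 andbT; apply/eqP => A0.
have : ae_eq P setT (fun x => epow (tau x) (gamma + 1)) (cst 0).
  apply/ae_eq_integral_abs => //.
  by under eq_integral do rewrite gee0_abs ?epow_ge0//.
move=> e0; have /andP[+ _] := momentP.
rewrite lt0e => /andP[/eqP + _]; apply.
rewrite -(integral0 P setT); apply: ge0_ae_eq_integral => //.
  by move=> x _; exact: epow_ge0.
apply: filterS3 e0 epow_fin epow_ae => x /(_ I) /= -> xoo [_ [/esym]].
move=> /powR_eq0_eq0 x0 _.
by rewrite -[LHS]fineK ?x0// ge0_fin_numE ?epow_ge0.
Qed.

Lemma abs_cont_tilted : abs_cont Qg P.
Proof.
move=> B mB PB; have [_ _ hE] := tilted_density; rewrite hE//.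
by apply: null_set_integral => //; apply/measurable_EFinP/measurable_funTS.
Qed.

(** The density [h] vanishes only where [tau] or [tau^gamma] is infinite, which is a [P]-null
    set. *)
Lemma abs_cont_tiltedV : (-1 < gamma)%R -> (gamma < 0)%R -> abs_cont P Qg.
Proof.
move=> g1 g0 B mB; have [_ _ hE] := tilted_density; rewrite hE// => hB.
have h0 : ae_eq P B (EFin \o h) (cst 0).
  apply/ae_eq_integral_abs => //.
    exact/measurable_EFinP/measurable_funTS.
  by rewrite -[RHS]hB; apply: eq_integral => x _; rewrite gee0_abs// lee_fin.
apply: measure_negligible => //.
have : \forall x \ae P, ~ B x.
  apply: filterS3 h0 epow_fin (tau_fin g1 g0) => x hx xoo tx Bx.
  have /= := hx Bx; move: xoo tx; have := tau0 x.
  case: (tau x) => [r||] //; rewrite lee_fin le_eqVlt => /predU1P[<-|r0] /=.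
    by rewrite ltxx [(0 < gamma)%R]ltNge (ltW g0)/= g0.
  rewrite r0/= => _ _ [] /eqP; apply/negP.
  by rewrite gt_eqF ?divr_gt0 ?powR_gt0.
by move=> [N [mN PN BN]]; exists N; split => // x Bx; apply: BN => /=; exact.
Qed.

(** Pointwise [tau^(gamma + 1) <= 1 + tau^gamma]: the power is at most [tau^gamma] for [tau <= 1]
    and at most 1 beyond. *)
Lemma moment_lty : (gamma < -1)%R -> A < +oo.
Proof.
move=> g1; have g1' : (gamma + 1 < 0)%R by rewrite -ltrBrDr sub0r.
have g0 : (gamma < 0)%R by rewrite (lt_trans g1)// oppr_lt0 ltr01.
have n0 : (0 < gamma)%R = false by rewrite ltNge ltW.
have n1 : (0 < gamma + 1)%R = false by rewrite ltNge ltW.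
apply: (@le_lt_trans _ _ (\int[P]_x (1 + epow (tau x) gamma))).
  apply: ge0_le_integral => //.
  - by move=> x _; exact: epow_ge0.
  - exact: emeasurable_funD.
  move=> x _; have := tau0 x; case: (tau x) => [r||] //=; last first.
    by rewrite n1 n0 g1' g0 adde_ge0.
  rewrite lee_fin le_eqVlt => /predU1P[<-|r0].
    by rewrite ltxx n1 n0 g1' g0 addey ?leey.
  rewrite r0 -EFinD lee_fin; have [r1|r1] := leP r 1%R.
    rewrite (@le_trans _ _ (r `^ gamma)%R) ?lerDr//.
    by rewrite ger_powR ?r0// lerDl.
  rewrite (@le_trans _ _ 1%R) ?lerDl ?powR_ge0//.
  by rewrite -[leRHS](powRr0 r) ler_powR ?ltW.
rewrite ge0_integralD//; last by move=> x _; exact: epow_ge0.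
rewrite lte_add_pinfty//; last by case/andP: momentP.
by rewrite integral_cst// mul1e (le_lt_trans (probability_le1 P measurableT)) ?ltry.
Qed.

(** The coefficients of [eln A] add up to [1 / (gamma + 1) + gamma / (gamma + 1) = 1], and that of
    [ln Z] is [- beta * gamma / (gamma + 1) = -1]. *)
Lemma upper_bound_tilted : (0 < gamma)%R ->
  dual_adde (((gamma + 1)^-1)%:E * eln A)
    (((gamma + 1 - 1)^-1)%:E * renyi_pos beta Qg P) = eln (\int[Qg]_x tau x).
Proof.
move=> g0; have b1 : (1 < beta)%R by rewrite ltrDl invr_gt0.
have g1 : (0 < gamma + 1)%R by rewrite addr_gt0.
rewrite renyi_posE ?gt_eqF// b1 asboolT/=; last exact: abs_cont_tilted.
rewrite muleA -EFinM eln_renyi_integral_tilted eln_integral_tilted.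
have -> : ((gamma + 1 - 1)^-1 * (beta * (beta - 1))^-1 =
    gamma / (gamma + 1))%R.
  by field; rewrite gamma1 gamma0/= mulN1r addrAC subrr add0r oner_neq0.
have k0 : (0 < gamma / (gamma + 1))%R by rewrite divr_gt0.
have k1 : (0 < (gamma + 1)^-1)%R by rewrite invr_gt0.
(* [A] may be infinite; both terms then have the same infinite value. *)
case: (eln A) => [r||].
- rewrite -!EFinB -!EFinM /dual_adde; congr (_%:E); field.
  by rewrite gamma1 gamma0.
- by rewrite !addye// !gt0_muley.
- by rewrite !addNye !gt0_muleNy.
Qed.

(** By [moment_gt0] and [A < +oo], [eln A] is real, so no difference of infinities arises and the
    identity is rational arithmetic in [gamma]. *)
Lemma lower_bound_tilted : (gamma < 0)%R -> A < +oo ->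
  ((gamma + 1)^-1)%:E * eln A -
    ((1 - (gamma + 1))^-1)%:E * renyi_pos (1 - (gamma + 1))^-1 P Qg =
  eln (\int[Qg]_x tau x).
Proof.
move=> g0 Aoo; have aE : ((1 - (gamma + 1))^-1 = 1 - beta)%R.
  by rewrite opprD addrCA subrr addr0 invrN opprD addrA subrr add0r.
have b1 : (1 - beta != 1)%R.
  by rewrite -subr_eq0 addrAC subrr add0r oppr_eq0.
rewrite aE renyi_posE// renyi_integralC eln_renyi_integral_tilted.
(* The [+oo] branch is excluded: by [abs_cont_tiltedV] if [-1 < gamma], and otherwise because
   [beta >= 0] makes the order at most 1. *)
rewrite eln_integral_tilted ifF; last first.
  have [g1|g1] := ltP (-1)%R gamma.
    by rewrite asboolT ?andbF//; exact: abs_cont_tiltedV.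
  apply/negbTE; rewrite negb_and -leNgt gerBl.
  have -> : (beta = (gamma + 1) / gamma)%R by field.
  by rewrite mulr_le0 ?invr_le0 ?(ltW g0)// -lerBrDr sub0r.
have [a Aa] : exists a, eln A = a%:E.
  have := moment_gt0; move: Aoo; case: A => [a||] // _ a0.
  by exists (ln a); rewrite lte_fin in a0; rewrite /= a0.
rewrite Aa -!EFinB; congr (_%:E).
have e1 : (gamma - (gamma + 1) = -1)%R by ring.
have e2 : (-1 + -1 * gamma = - (gamma + 1))%R by ring.
by field; rewrite e1 e2 !oppr_eq0 oner_eq0 gamma1 gamma0.
Qed.

End tilted_measure.

(** * Attained extrema and the assembly of the theorem *)

Lemma ereal_sup_max {R : realType} (S : set (\bar R)) (x : \bar R) :
  S x -> (forall y, S y -> y <= x) -> ereal_sup S = x.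
Proof.
move=> Sx xS; apply/le_anti; rewrite ereal_sup_ubound// andbT.
by apply: ge_ereal_sup => y /xS.
Qed.

Lemma ereal_inf_min {R : realType} (S : set (\bar R)) (x : \bar R) :
  S x -> (forall y, S y -> x <= y) -> ereal_inf S = x.
Proof.
move=> Sx xS; apply/le_anti; rewrite ereal_inf_lbound//=.
by apply: le_ereal_inf_tmp => y /xS.
Qed.

Unset Implicit Arguments.

Theorem mainTheorem13 (d : measure_display) (T : measurableType d) (R : realType)
  (P : probability T R) (tau : T -> \bar R) (gamma : R)
  (Qg : probability T R) :
  measurable_fun setT tau -> (forall x, 0 <= tau x) ->
  gamma != 0%R -> gamma != (-1)%R ->
  0 < \int[P]_x epow (tau x) gamma < +oo ->
  (forall A, measurable A ->
     Qg A = (\int[P]_(x in A) epow (tau x) gamma) *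
            ((fine (\int[P]_x epow (tau x) gamma))^-1)%:E) ->
  let logE (Q : probability T R) := eln (\int[Q]_x tau x) in
  let beta := (1 + gamma^-1)%R in
  let Lc (c : R) := eln (\int[P]_x epow (tau x) c) in
  (forall (I : set R) (b : R), I b -> UI P Qg I Qg /\ UI P Qg I `<=` Ubeta P Qg b) /\
  ((0 < gamma)%R ->
     let F (c : R) := dual_adde ((c^-1)%:E * Lc c)
                         (((c - 1)^-1)%:E * renyi (c / (c - 1)) Qg P) in
     [/\ ereal_sup [set logE Q | Q in UI P Qg `]1%R, +oo[%classic] =
         ereal_sup [set logE Q | Q in Ubeta P Qg beta],
         ereal_sup [set logE Q | Q in Ubeta P Qg beta] = logE Qg,
         logE Qg = ereal_inf [set F c | c in `]1%R, +oo[%classic] &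
         F (gamma + 1)%R = ereal_inf [set F c | c in `]1%R, +oo[%classic]]) /\
  ((-1 < gamma)%R -> (gamma < 0)%R ->
     {ae P, forall x, tau x < +oo} ->
     \int[P]_x epow (tau x) (gamma + 1) < +oo ->
     let G (c : R) := (c^-1)%:E * Lc c -
                      ((1 - c)^-1)%:E * renyi (1 - c)^-1 P Qg in
     [/\ ereal_inf [set logE Q | Q in UI P Qg `]-oo, 0%R[%classic] =
         ereal_inf [set logE Q | Q in Ubeta P Qg beta],
         ereal_inf [set logE Q | Q in Ubeta P Qg beta] = logE Qg,
         logE Qg = ereal_sup [set G c | c in [set c : R | (c < 1)%R /\ c != 0%R]] &
         G (gamma + 1)%R = ereal_sup [set G c | c in [set c : R | (c < 1)%R /\ c != 0%R]]]) /\
  ((gamma < -1)%R ->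
     let G (c : R) := (c^-1)%:E * Lc c -
                      ((1 - c)^-1)%:E * renyi (1 - c)^-1 P Qg in
     [/\ ereal_inf [set logE Q | Q in UI P Qg `]0%R, 1%R[%classic] =
         ereal_inf [set logE Q | Q in Ubeta P Qg beta],
         ereal_inf [set logE Q | Q in Ubeta P Qg beta] = logE Qg,
         logE Qg = ereal_sup [set G c | c in [set c : R | (c < 1)%R /\ c != 0%R]] &
         G (gamma + 1)%R = ereal_sup [set G c | c in [set c : R | (c < 1)%R /\ c != 0%R]]]).
Proof.
move=> mtau tau0 g0 gN1 momP QgE logE beta Lc.
have UIU I b : I b -> UI P Qg I Qg /\ UI P Qg I `<=` Ubeta P Qg b.
  by move=> Ib; split => [a _ /=|Q QI]; [exact: lexx|exact: QI].
pose G (c : R) := (c^-1)%:E * Lc c -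
  ((1 - c)^-1)%:E * renyi (1 - c)^-1 P Qg.
(* Parts (2) and (3) share this argument. They differ in why [R_beta(Q || P)] equals
   [R_(1 - beta)(P || Q)]: by definition for [beta < 0], by [renyi_posC] for [0 < beta < 1]. *)
have lower (I : set R) : (gamma < 0)%R ->
    ((-1 < gamma)%R -> (gamma < 0)%R -> {ae P, forall x, tau x < +oo}) ->
    \int[P]_x epow (tau x) (gamma + 1) < +oo -> I beta ->
    (forall Q, renyi beta Q P = renyi_pos (1 - beta) P Q) ->
    [/\ ereal_inf [set logE Q | Q in UI P Qg I] =
        ereal_inf [set logE Q | Q in Ubeta P Qg beta],
        ereal_inf [set logE Q | Q in Ubeta P Qg beta] = logE Qg,
        logE Qg = ereal_sup [set G c | c in [set c : R | (c < 1)%R /\ c != 0%R]] &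
        G (gamma + 1)%R =
        ereal_sup [set G c | c in [set c : R | (c < 1)%R /\ c != 0%R]]].
  move=> gneg tf Aoo bI renyi_beta; have [QgU UU] := UIU _ _ bI.
  have aE : ((1 - (gamma + 1))^-1 = 1 - beta)%R.
    by rewrite opprD addrCA subrr addr0 invrN opprD addrA subrr add0r.
  have g1 : (gamma + 1 < 1)%R by rewrite gtrDr.
  have g1' : (gamma + 1 != 0)%R by rewrite addr_eq0.
  have renyiE c Q : (c < 1)%R ->
      renyi (1 - c)^-1 P Q = renyi_pos (1 - c)^-1 P Q.
    move=> c1; rewrite /renyi ifF//; apply/negbTE; rewrite -leNgt.
    by rewrite invr_ge0 subr_ge0 ltW.
  have Gg : G (gamma + 1)%R = logE Qg.
    rewrite /G renyiE//.
    exact: (lower_bound_tilted mtau tau0 g0 gN1 momP QgE tf gneg Aoo).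
  (* At [c = gamma + 1] the lower bound for [Q] contains exactly the divergence constrained by
     [Ubeta]; enlarging it to that of [Qg] lowers the bound to [G (gamma + 1)]. *)
  have Ulb Q : Ubeta P Qg beta Q -> logE Qg <= logE Q.
    rewrite /Ubeta/= !renyi_beta -aE => QU; rewrite -Gg /G renyiE//.
    apply: le_trans (renyi_pos_lower Q P mtau tau0 g1 g1').
    by apply: le_subeZ => //; rewrite invr_gt0 subr_gt0.
  have supE : ereal_sup [set G c | c in [set c : R | (c < 1)%R /\ c != 0%R]] =
      logE Qg.
    apply: ereal_sup_max; first by exists (gamma + 1)%R.
    move=> _ [c /= [c1 c0] <-]; rewrite /G renyiE//.
    exact: renyi_pos_lower.
  have infE : ereal_inf [set logE Q | Q in Ubeta P Qg beta] = logE Qg.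
    apply: ereal_inf_min; first by exists Qg => //=; exact: lexx.
    by move=> _ [Q /= QU <-]; exact: Ulb.
  split; rewrite ?supE ?infE ?Gg//.
  (* The infimum over [UI] is squeezed: this set contains [Qg] and lies inside [Ubeta]. *)
  apply: ereal_inf_min; first by exists Qg.
  by move=> _ [Q /= /UU QU <-]; exact: Ulb.
(* The quotient shows the sign of [beta]: negative for [-1 < gamma < 0], positive for
   [gamma < -1]. *)
have bE : (beta = (gamma + 1) / gamma)%R by rewrite /beta; field.
split => //; split; [|split].
- move=> gpos F.
  have b1 : (1 < beta)%R by rewrite ltrDl invr_gt0.
  have g1 : (1 < gamma + 1)%R by rewrite ltrDr.
  have cE : ((gamma + 1) / (gamma + 1 - 1) = beta)%R by rewrite addrK bE.
  have tf : (-1 < gamma)%R -> (gamma < 0)%R -> {ae P, forall x, tau x < +oo}.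
    by move=> _; rewrite ltNge (ltW gpos).
  have renyiE c Q : (1 < c)%R ->
      renyi (c / (c - 1)) Q P = renyi_pos (c / (c - 1)) Q P.
    move=> c1; rewrite /renyi ifF//; apply/negbTE; rewrite -leNgt.
    by rewrite divr_ge0 ?subr_ge0 ?(ltW c1)// (le_trans ler01) ?ltW.
  have Fg : F (gamma + 1)%R = logE Qg.
    rewrite /F renyiE// cE.
    exact: (upper_bound_tilted mtau tau0 g0 gN1 momP QgE tf gpos).
  (* At [c = gamma + 1] the order [c / (c - 1)] is [beta], so membership in [Ubeta] bounds the
     divergence term by that of [Qg]. *)
  have Uub Q : Ubeta P Qg beta Q -> logE Q <= logE Qg.
    move=> QU; rewrite -Fg /F renyiE//.
    apply: le_trans (renyi_pos_upper Q P mtau tau0 g1) _.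
    rewrite -!renyiE// cE; apply: le_dual_addeZ => //.
    by rewrite invr_gt0 addrK.
  have infE : ereal_inf [set F c | c in `]1%R, +oo[%classic] = logE Qg.
    apply: ereal_inf_min; first by exists (gamma + 1)%R; rewrite //= in_itv/= g1.
    move=> _ [c /= + <-]; rewrite in_itv/= andbT => c1.
    by rewrite /F renyiE//; exact: renyi_pos_upper.
  have supE : ereal_sup [set logE Q | Q in Ubeta P Qg beta] = logE Qg.
    apply: ereal_sup_max; first by exists Qg => //=; exact: lexx.
    by move=> _ [Q /= QU <-]; exact: Uub.
  have bI : `]1%R, +oo[%classic beta by rewrite /= in_itv/= b1.
  have [QgU UU] := UIU _ _ bI.
  split; rewrite ?supE ?infE ?Fg//.
  apply: ereal_sup_max; first by exists Qg.
  by move=> _ [Q /= /UU QU <-]; exact: Uub.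
- move=> gm1 gneg tf Aoo; have b0 : (beta < 0)%R.
    by rewrite bE pmulr_rlt0 ?invr_lt0// -ltrBlDr sub0r.
  apply: (lower _ gneg (fun _ _ => tf) Aoo); first by rewrite /= in_itv/= b0.
  by move=> Q; rewrite /renyi b0.
- move=> gm1; have gneg : (gamma < 0)%R.
    by rewrite (lt_trans gm1)// oppr_lt0 ltr01.
  have b1 : (beta < 1)%R by rewrite /beta gtrDl invr_lt0.
  have b0 : (0 < beta)%R.
    by rewrite bE nmulr_rgt0 ?invr_lt0// -ltrBrDr sub0r.
  apply: lower => //.
  + by rewrite ltNge (ltW gm1).
  + exact: moment_lty.
  + by rewrite /= in_itv/= b0 b1.
  + by move=> Q; rewrite /renyi ltNge (ltW b0)/= renyi_posC// b0 b1.
Qed.
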